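(* Assume that $f(x,y,z)$ is convex in $y$ on $Y$ for any given $x\in X$, $z\in Z$, and concave in $z$ on $Z$ for any given $x\in X$, $y\in Y$. Let $\gamma_1,\gamma_2>0$. Then the problem $$\min_{(x,y,z)\in X\times Y\times Z}F(x,y,z)\quad\text{s.t. }\mathcal{G}^{\mathrm{saddle}}_\gamma(x,y,z)\le0$$ is equivalent to the bilevel optimization problem with minimax lower level $$\min_{x\in X,\,y\in Y,\,z\in Z}F(x,y,z)\quad\text{s.t. }(y,z)\in\mathcal{SP}(x),$$ in the sense that a point $(x,y,z)\in X\times Y\times Z$ is feasible for one problem if and only if it is feasible for the other (the objectives being identical).
   Context: $X\subseteq\mathbb{R}^n$, $Y\subseteq\mathbb{R}^m$ and $Z\subseteq\mathbb{R}^p$ are closed convex sets; $F,f:X\times Y\times Z\to\mathbb{R}$ are continuously differentiable. $\mathcal{SP}(x)$ denotes the set of saddle points $(y,z)\in Y\times Z$ of the minimax problem $\min_{y\in Y}\max_{z\in Z}f(x,y,z)$, i.e. $f(x,y,\lambda)\le f(x,y,z)\le f(x,\theta,z)$ for all $\theta\in Y$, $\lambda\in Z$. For $\gamma=(\gamma_1,\gamma_2)$, $$\mathcal{G}^{\mathrm{saddle}}_{\gamma}(x,y,z):=\max_{\theta\in Y,\ \lambda\in Z}\Big\{f(x,y,\lambda)-\tfrac1{2\gamma_2}\|\lambda-z\|^2-f(x,\theta,z)-\tfrac1{2\gamma_1}\|\theta-y\|^2\Big\}.$$ *)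

(* Defs.v *)
From HB Require Import structures.
From mathcomp Require Import all_boot all_order all_algebra.
From mathcomp Require Import all_classical all_reals all_analysis.

Set Implicit Arguments.
Unset Strict Implicit.
Unset Printing Implicit Defensive.

Import Order.TTheory GRing.Theory Num.Theory.
Import numFieldNormedType.Exports.

Local Open Scope classical_set_scope.
Local Open Scope ring_scope.

(* The library norm on 'rV[R]_n is the sup norm; this is the Euclidean one. *)
Definition euclidean_norm (R : realType) (n : nat) (u : 'rV[R]_n) : R :=
  Num.sqrt (\sum_(i < n) u 0 i ^+ 2).

(* A function on a set D that need not be open is continuously differentiable
   when it agrees on D with a function that is C^1 on an open set containing D;
   the values of f outside D are irrelevant. In finite dimension, continuity of
   w |-> 'd g w v for every direction v is continuity of the differential. *)
Definition continuously_differentiable_on (R : realType) (V : normedModType R)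
    (D : set V) (f : V -> R^o) : Prop :=
  exists (U : set V) (g : V -> R^o),
    [/\ open U, D `<=` U, {in D, f =1 g},
        forall w, U w -> differentiable g w &
        forall v w, U w -> {for w, continuous (fun w' => 'd g w' v)}].

Definition concave_function (R : realType) (V : lmodType R)
    (D : set V) (f : V -> R) : Prop :=
  convex_function D (fun v => - f v : R^o).

Section MinimaxProblem.
Context (R : realType) (n m p : nat).
Local Notation space := ('rV[R]_n * 'rV[R]_m * 'rV[R]_p)%type.
Implicit Types (X : set 'rV[R]_n) (Y : set 'rV[R]_m) (Z : set 'rV[R]_p).
Implicit Types (F f : space -> R).

Definition saddle_points Y Z f (x : 'rV[R]_n) : set ('rV[R]_m * 'rV[R]_p) :=
  [set yz | [/\ Y yz.1, Z yz.2 &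
     forall theta lambda, Y theta -> Z lambda ->
       f (x, yz.1, lambda) <= f (x, yz.1, yz.2) <= f (x, theta, yz.2)]].

Definition saddle_gap_obj f (gamma1 gamma2 : R) (w : space)
    (tl : 'rV[R]_m * 'rV[R]_p) : R :=
  let: (x, y, z) := w in let: (theta, lambda) := tl in
  f (x, y, lambda) - (2 * gamma2)^-1 * euclidean_norm (lambda - z) ^+ 2
  - f (x, theta, z) - (2 * gamma1)^-1 * euclidean_norm (theta - y) ^+ 2.

(* The maximum over Y * Z is taken as a supremum in the extended reals, so that
   the gap is defined (possibly +oo) without any assumption; it is the maximum
   whenever the latter is attained, see saddle_gap_max. *)
Definition saddle_gap Y Z f (gamma1 gamma2 : R) (w : space) : \bar R :=
  ereal_sup [set (saddle_gap_obj f gamma1 gamma2 w tl)%:E | tl in Y `*` Z].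

Lemma saddle_gap_max Y Z f (gamma1 gamma2 : R) (w : space) tl :
  (Y `*` Z) tl ->
  (forall tl', (Y `*` Z) tl' ->
     saddle_gap_obj f gamma1 gamma2 w tl' <= saddle_gap_obj f gamma1 gamma2 w tl) ->
  saddle_gap Y Z f gamma1 gamma2 w = (saddle_gap_obj f gamma1 gamma2 w tl)%:E.
Proof.
move=> YZtl tlmax; apply/eqP; rewrite eq_le; apply/andP; split.
  by apply: ge_ereal_sup => _ [tl' YZtl' <-]; rewrite lee_fin tlmax.
by apply: ereal_sup_ubound; exists tl.
Qed.

Record min_problem (T : Type) := MinProblem {
  objective : T -> R;
  feasible : set T
}.

Definition equivalent_problems (T : Type) (P Q : min_problem T) : Prop :=
  (forall w, feasible P w <-> feasible Q w) /\
  (forall w, feasible P w -> objective P w = objective Q w).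

Definition saddle_gap_problem X Y Z F f (gamma1 gamma2 : R) :
    min_problem space :=
  MinProblem F [set w | (X `*` Y `*` Z) w /\
                        (saddle_gap Y Z f gamma1 gamma2 w <= 0)%E].

Definition bilevel_minimax_problem X Y Z F f : min_problem space :=
  MinProblem F [set w | (X `*` Y `*` Z) w /\
                        saddle_points Y Z f w.1.1 (w.1.2, w.2)].

End MinimaxProblem.

(* Main.v *)
(* The proximal penalties vanish to second order at (y, z), whereas along a
   segment issuing from it a convex function that decreases does so to first
   order: a global minimum of the penalized function at its proximal centre is
   thus a global minimum of the convex function itself. Taking lambda = z, resp.
   theta = y, in the gap isolates one player at a time. *)

Require Import Defs.
From mathcomp Require Import all_boot all_order all_algebra.
From mathcomp Require Import all_classical all_reals all_analysis.
From mathcomp Require Import lra.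

Import Order.TTheory GRing.Theory Num.Theory.
Import numFieldNormedType.Exports.

Local Open Scope classical_set_scope.
Local Open Scope ring_scope.

(** This makes the proximal penalty second order in the step along a segment; in squared form no
    absolute value of [t] appears. *)
Lemma euclidean_norm_sqrZ (R : realType) (n : nat) (t : R) (u : 'rV[R]_n) :
  euclidean_norm (t *: u) ^+ 2 = t ^+ 2 * euclidean_norm u ^+ 2.
Proof.
have sqsum_ge0 (v : 'rV[R]_n) : 0 <= \sum_(i < n) v 0 i ^+ 2.
  by apply: sumr_ge0 => i _; exact: sqr_ge0.
rewrite /euclidean_norm !sqr_sqrtr// mulr_sumr.
by apply: eq_bigr => i _; rewrite mxE exprMn.
Qed.

Lemma euclidean_norm0 (R : realType) (n : nat) :
  euclidean_norm (0 : 'rV[R]_n) = 0.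
Proof.
by rewrite /euclidean_norm big1 ?sqrtr0// => i _; rewrite mxE expr0n.
Qed.

Lemma proximal_minimum (R : realType) (n : nat) (D : set 'rV[R]_n)
    (g : 'rV[R]_n -> R) (c : R) (y : 'rV[R]_n) :
  convex_set D -> convex_function D g -> 0 <= c -> D y ->
  (forall th, D th -> g y <= g th + c * euclidean_norm (th - y) ^+ 2) ->
  forall th, D th -> g y <= g th.
Proof.
move=> cD cg c0 Dy ymin th Dth; rewrite leNgt; apply/negP => gth.
set K := c * euclidean_norm (th - y) ^+ 2.
have K0 : 0 <= K by rewrite mulr_ge0// sqr_ge0.
set d := g y - g th.
have d0 : 0 < d by rewrite subr_gt0.
have dK0 : 0 < d + K by rewrite ltr_wpDr.
(* The step d / (d + K) is chosen so that t * d > t ^ 2 * K. *)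
pose t := d / (d + K).
have t0 : 0 < t by rewrite divr_gt0.
have t1 : t <= 1 by rewrite ler_pdivrMr// mul1r lerDl.
have tdK : t * (d + K) = d by rewrite divfK// gt_eqF.
pose w := t *: th + (1 - t) *: y.
have Dw : D w.
  apply/set_mem.
  by apply: (cD th y (Itv01 (ltW t0) t1)); apply/mem_set.
have gw : g w <= t * g th + (1 - t) * g y.
  by apply: (cg (Itv01 (ltW t0) t1) th y); apply/mem_set.
have wy : w - y = t *: (th - y).
  by rewrite /w scalerBl scale1r scalerBr addrA addrAC addrK.
have := ymin _ Dw; rewrite wy euclidean_norm_sqrZ mulrCA -/K => gyw.
(* Convexity makes the decrease from [g y] to [g w] at least [t * d]; penalized minimality at [y]
   makes it at most the penalty [t ^+ 2 * K]. *)
have : t * d <= t ^+ 2 * K by rewrite /d; lra.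
(* Writing the left-hand [d] as [t * (d + K)] and cancelling [t ^+ 2 * K] leaves [t * t * d <= 0],
   which is absurd. *)
by rewrite -{1}tdK expr2 mulrA mulrDr gerDr leNgt (mulr_gt0 (mulr_gt0 t0 t0) d0).
Qed.

Theorem theoremA8 (R : realType) (n m p : nat)
    (X : set 'rV[R]_n) (Y : set 'rV[R]_m) (Z : set 'rV[R]_p)
    (F f : 'rV[R]_n * 'rV[R]_m * 'rV[R]_p -> R) (gamma1 gamma2 : R)
    (X_closed : closed X) (X_convex : convex_set X)
    (Y_closed : closed Y) (Y_convex : convex_set Y)
    (Z_closed : closed Z) (Z_convex : convex_set Z)
    (F_C1 : continuously_differentiable_on (X `*` Y `*` Z) F)
    (f_C1 : continuously_differentiable_on (X `*` Y `*` Z) f)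
    (f_convex : forall x z, X x -> Z z ->
       convex_function Y (fun y => f (x, y, z)))
    (f_concave : forall x y, X x -> Y y ->
       concave_function Z (fun z => f (x, y, z)))
    (gamma1_gt0 : 0 < gamma1) (gamma2_gt0 : 0 < gamma2) :
  equivalent_problems (saddle_gap_problem X Y Z F f gamma1 gamma2)
                      (bilevel_minimax_problem X Y Z F f).
Proof.
split=> // -[[x y] z] /=.
have c1 : 0 <= (2 * gamma1)^-1 by rewrite invr_ge0 mulr_ge0// ltW.
have c2 : 0 <= (2 * gamma2)^-1 by rewrite invr_ge0 mulr_ge0// ltW.
split=> -[XYZ].
  move: (XYZ) => -[[/= Xx Yy] Zz] gap; split=> //; split=> //= th la Yth Zla.
  have obj th' la' : Y th' -> Z la' ->
      saddle_gap_obj f gamma1 gamma2 (x, y, z) (th', la') <= 0.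
    move=> Yth' Zla'; rewrite -lee_fin; apply: le_trans gap.
    by apply: ereal_sup_ubound; exists (th', la').
  apply/andP; split.
    (* Maximality in [z] becomes minimality of the convex function [- f (x, y, _)]; in [obj y la']
       the first player's penalty vanishes, which leaves exactly the penalized inequality. *)
    rewrite -lerN2.
    apply: (proximal_minimum _ _ _ (fun z' => - f (x, y, z')) _ _ Z_convex
      (f_concave _ _ Xx Yy) c2 Zz) => // la' Zla'.
    have /= := obj y la' Yy Zla'.
    by rewrite subrr euclidean_norm0 expr0n mulr0 subr0; lra.
  apply: (proximal_minimum _ _ _ (fun y' => f (x, y', z)) _ _ Y_convex
    (f_convex _ _ Xx Zz) c1 Yy) => // th' Yth'.
  have /= := obj th' z Yth' Zz.
  by rewrite subrr euclidean_norm0 expr0n mulr0 subr0; lra.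
move=> [/= Yy Zz sad]; split=> //.
(* Each value is [f (x, y, la) - f (x, th, z)] minus nonnegative penalties, and the saddle
   inequalities chain through [f (x, y, z)]. *)
apply: ge_ereal_sup => _ [[th la] [/= Yth Zla] <-]; rewrite lee_fin.
have /andP[fla fth] := sad _ _ Yth Zla.
have p1 := mulr_ge0 c1 (sqr_ge0 (euclidean_norm (th - y))).
have p2 := mulr_ge0 c2 (sqr_ge0 (euclidean_norm (la - z))).
by lra.
Qed.
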